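(* Let $0<\epsilon<1/4$. Suppose that $Y$ is the Stone-Čech compactification of a discrete space with at least two points, and that $X$ is an infinite compact Hausdorff space. Let $T:C(X)\to C(Y)$ be an $\epsilon$-disjointness preserving operator with $\|T\|=1$. Then there exists a weighted composition map $S:C(X)\to C(Y)$ such that $\|T-S\|\le 2\sqrt{\epsilon}$. Furthermore, if $X$ does not admit an atomless regular Borel probability measure and $Y$ is finite (with at least two points), then there exists a weighted composition map $S:C(X)\to C(Y)$ such that $\|T-S\|<2\sqrt{\epsilon}$.
   Context: $\mathbb{K}$ denotes $\mathbb{R}$ or $\mathbb{C}$. For a compact Hausdorff space $Z$, $C(Z)$ is the Banach space of $\mathbb{K}$-valued continuous functions on $Z$ with the sup norm $\|\cdot\|_\infty$; norms of operators are operator norms. For $\epsilon>0$, an operator $T:C(X)\to C(Y)$ is $\epsilon$-disjointness preserving if it is linear, continuous, and $\|(Tf)(Tg)\|_\infty\le\epsilon$ whenever $f,g\in C(X)$ satisfy $\|f\|_\infty=\|g\|_\infty=1$ and $fg\equiv 0$. An operator $S:C(X)\to C(Y)$ is a weighted composition map if there exist $a\in C(Y)$ and a map $h:Y\to X$, continuous on $c(a):=\{y\in Y:a(y)\ne 0\}$, such that $(Sf)(y)=a(y)f(h(y))$ for every $f\in C(X)$ and $y\in Y$ (the case $S\equiv 0$ is included). *)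

(* Defs.v *)
From HB Require Import structures.
From mathcomp Require Import all_boot all_order all_algebra.
From mathcomp Require Import complex.
From mathcomp Require Import all_classical all_reals all_analysis.

Set Implicit Arguments.
Unset Strict Implicit.
Unset Printing Implicit Defensive.

Import Order.TTheory GRing.Theory Num.Theory.
Import numFieldNormedType.Exports.

Local Open Scope classical_set_scope.
Local Open Scope ring_scope.

Variant scalar_kind := RealScalars | ComplexScalars.

Definition scalars (R : realType) (k : scalar_kind) : numFieldType :=
  match k with RealScalars => R | ComplexScalars => R[i] end.

(* The norm [`|z|] of [z : R[i]] is itself an element of [R[i]]; [modulus] is
   the absolute value with values in [R]. *)
Definition modulus (R : realType) (k : scalar_kind) : scalars R k -> R :=
  match k return scalars R k -> R with
  | RealScalars => fun x => `|x|
  | ComplexScalars => fun z => complex.Re `|z|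
  end.
Arguments modulus {R k}.

Lemma nbhs_dist_ltS (K : numFieldType) (x e : K) (P : set K) :
  0 < e -> (forall y, `|x - y| < e -> P y) -> nbhs x P.
Proof.
by move=> e0 xP; apply/nbhs_ballP; exists e.
Qed.

Section modulus_theory.
Context {R : realType} {k : scalar_kind}.
Implicit Types x y : scalars R k.

Lemma modulusD x y : modulus (x + y) <= modulus x + modulus y.
Proof.
case: k x y => x y /=; first exact: ler_normD.
by have := ler_normD x y; rewrite lecE => /andP[_].
Qed.

Lemma modulus_ge0 x : 0 <= modulus x.
Proof.
case: k x => x /=; first exact: normr_ge0.
by have := normr_ge0 x; rewrite lecE => /andP[_].
Qed.

Lemma modulus0_eq0 x : modulus x = 0 -> x = 0.
Proof.
case: k x => x /=; first exact: normr0_eq0.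
exact: ComplexField.Normc.eq0_normc.
Qed.

Lemma modulusN x : modulus (- x) = modulus x.
Proof. by case: k x => x; rewrite /modulus normrN. Qed.

Lemma modulusMn x n : modulus (x *+ n) = modulus x *+ n.
Proof.
case: k x => x; rewrite /modulus normrMn //.
by elim: n => [|n IHn]; rewrite ?mulr0n // !mulrS raddfD /= IHn.
Qed.

Lemma modulus0 : modulus (0 : scalars R k) = 0.
Proof. by rewrite -(mulr0n 0) modulusMn mulr0n. Qed.

Lemma modulus_continuous : continuous (@modulus R k).
Proof.
have small x (e : R) : 0 < e -> nbhs x [set y | modulus (x - y) < e].
  move=> e0; case: k x => x; first exact: (nbhs_dist_ltS e0).
  have e0' : (0 : R[i]) < e%:C%C by rewrite ltcR.
  apply: (nbhs_dist_ltS e0') => y.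
  by rewrite ltcE => /andP[_].
move=> x; have xF : Filter (nbhs x) by exact: nbhs_filter.
apply/cvgrPdist_lt => e e0; apply: (filterS _ (small x e e0)) => y /= xy.
have yx : modulus (y - x) < e by rewrite -modulusN opprB.
rewrite ltr_norml; apply/andP; split.
  rewrite ltrNl opprB ltrBlDr.
  apply: le_lt_trans (_ : _ <= modulus (y - x) + modulus x) _.
    by rewrite -{1}(subrK x y) modulusD.
  by rewrite ltrD2r.
rewrite ltrBlDr.
apply: le_lt_trans (_ : _ <= modulus (x - y) + modulus y) _.
  by rewrite -{1}(subrK y x) modulusD.
by rewrite ltrD2r.
Qed.

End modulus_theory.

HB.mixin Record isCompactHausdorff T of Topological T := {
  compactT : compact [set: T];
  hausdorffT : hausdorff_space T
}.

#[short(type="compactHausdorffType")]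
HB.structure Definition CompactHausdorff :=
  { T of Topological T & isCompactHausdorff T }.

(* The library's measurable types are pointed, so Borel measures are only
   available on a space with a distinguished point. *)
#[short(type="pcompactHausdorffType")]
HB.structure Definition PointedCompactHausdorff :=
  { T of PointedTopological T & isCompactHausdorff T }.

(* The alias keeps the sup-norm structure declared below apart from the function
   space topologies that the library puts on [continuousType]. *)
Definition cfun (R : realType) (k : scalar_kind) (Z : compactHausdorffType) :=
  continuousType Z (scalars R k).

Section cfun_algebra.
Context {R : realType} {k : scalar_kind} {Z : compactHausdorffType}.
Implicit Types (f g h : cfun R k Z) (a b : scalars R k).

HB.instance Definition _ :=
  Choice.copy (cfun R k Z) (continuousType Z (scalars R k)).

Lemma cfunP f g : (forall z, f z = g z) -> f = g.
Proof. by move=> fg; apply/continuousEP. Qed.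

Fact cfun_const_subproof a : continuous (cst a : Z -> scalars R k).
Proof. exact: cst_continuous. Qed.
Definition cfun_const a : cfun R k Z := mkcts (@cfun_const_subproof a).

Fact cfun_opp_subproof f : continuous (fun z => - f z).
Proof. by move=> z; apply: continuousN; exact: cts_fun. Qed.
Definition cfun_opp f : cfun R k Z := mkcts (@cfun_opp_subproof f).

Fact cfun_add_subproof f g : continuous (fun z => f z + g z).
Proof. by move=> z; apply: continuousD; exact: cts_fun. Qed.
Definition cfun_add f g : cfun R k Z := mkcts (@cfun_add_subproof f g).

Fact cfun_mul_subproof f g : continuous (fun z => f z * g z).
Proof. by move=> z; apply: continuousM; exact: cts_fun. Qed.
Definition cfun_mul f g : cfun R k Z := mkcts (@cfun_mul_subproof f g).

Definition cfun_scale a f : cfun R k Z := cfun_mul (cfun_const a) f.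

Fact cfun_addA : associative cfun_add.
Proof. by move=> f g h; apply: cfunP => z; exact: addrA. Qed.
Fact cfun_addC : commutative cfun_add.
Proof. by move=> f g; apply: cfunP => z; exact: addrC. Qed.
Fact cfun_add0 : left_id (cfun_const 0) cfun_add.
Proof. by move=> f; apply: cfunP => z; exact: add0r. Qed.
Fact cfun_addN : left_inverse (cfun_const 0) cfun_opp cfun_add.
Proof. by move=> f; apply: cfunP => z; exact: addNr. Qed.

HB.instance Definition _ := GRing.isZmodule.Build (cfun R k Z)
  cfun_addA cfun_addC cfun_add0 cfun_addN.

Fact cfun_mulA : associative cfun_mul.
Proof. by move=> f g h; apply: cfunP => z; exact: mulrA. Qed.
Fact cfun_mulC : commutative cfun_mul.
Proof. by move=> f g; apply: cfunP => z; exact: mulrC. Qed.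
Fact cfun_mul1 : left_id (cfun_const 1) cfun_mul.
Proof. by move=> f; apply: cfunP => z; exact: mul1r. Qed.
Fact cfun_mulDl : left_distributive cfun_mul +%R.
Proof. by move=> f g h; apply: cfunP => z; exact: mulrDl. Qed.

HB.instance Definition _ := GRing.Zmodule_isComPzRing.Build (cfun R k Z)
  cfun_mulA cfun_mulC cfun_mul1 cfun_mulDl.

Fact cfun_scaleA a b f : cfun_scale a (cfun_scale b f) = cfun_scale (a * b) f.
Proof. by apply: cfunP => z; exact: mulrA. Qed.
Fact cfun_scale1 : left_id 1 cfun_scale.
Proof. by move=> f; apply: cfunP => z; exact: mul1r. Qed.
Fact cfun_scaleDr : right_distributive cfun_scale +%R.
Proof. by move=> a f g; apply: cfunP => z; exact: mulrDr. Qed.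
Fact cfun_scaleDl f : {morph cfun_scale^~ f : a b / a + b}.
Proof. by move=> a b; apply: cfunP => z; exact: mulrDl. Qed.

HB.instance Definition _ :=
  GRing.Zmodule_isLmodule.Build (scalars R k) (cfun R k Z)
    cfun_scaleA cfun_scale1 cfun_scaleDr cfun_scaleDl.

End cfun_algebra.

Section cfun_norm.
Context {R : realType} {k : scalar_kind} {Z : compactHausdorffType}.
Implicit Types f g : cfun R k Z.

Definition cfun_norm f : R := sup (range (fun z => modulus (f z))).

Lemma cfun_norm_has_ubound f : has_ubound (range (fun z => modulus (f z))).
Proof.
have cf : continuous (fun z => modulus (f z)).
  by move=> z; apply: continuous_comp; [exact: cts_fun|exact: modulus_continuous].
have /compact_bounded[M [_ MP]] : compact (range (fun z => modulus (f z))).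
  by apply: continuous_compact; [exact: continuous_subspaceT|exact: compactT].
exists (M + 1) => r fr; apply: le_trans (ler_norm r) _.
by apply: MP fr; rewrite ltrDl.
Qed.

Lemma le_cfun_norm f z : modulus (f z) <= cfun_norm f.
Proof. by apply: ub_le_sup; [exact: cfun_norm_has_ubound|exists z]. Qed.

Lemma cfun_norm_ge0 f : 0 <= cfun_norm f.
Proof.
have [z0|/set0P[_ [z _ _]]] := eqVneq (range (fun z => modulus (f z))) set0.
  by rewrite /cfun_norm z0 sup0.
exact: le_trans (modulus_ge0 _) (le_cfun_norm f z).
Qed.

Lemma cfun_norm_le f (M : R) :
  0 <= M -> (forall z, modulus (f z) <= M) -> cfun_norm f <= M.
Proof.
move=> M0 fM.
have [z0|/set0P ne] := eqVneq (range (fun z => modulus (f z))) set0.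
  by rewrite /cfun_norm z0 sup0.
by apply: ge_sup => // _ [z _ <-].
Qed.

Fact cfun_normD f g : cfun_norm (f + g) <= cfun_norm f + cfun_norm g.
Proof.
apply: cfun_norm_le => [|z]; first by rewrite addr_ge0 // cfun_norm_ge0.
by apply: le_trans (modulusD _ _) _; rewrite lerD // le_cfun_norm.
Qed.

Fact cfun_norm0_eq0 f : cfun_norm f = 0 -> f = 0.
Proof.
move=> f0; apply: cfunP => z.
have fz0 : modulus (f z) <= 0 by rewrite -f0; exact: le_cfun_norm.
suff /modulus0_eq0 : modulus (f z) = 0 by [].
by apply: le_anti; rewrite fz0; exact: modulus_ge0.
Qed.

Fact cfun_normN f : cfun_norm (- f) = cfun_norm f.
Proof.
rewrite /cfun_norm; suff -> : (fun z => modulus ((- f) z)) = (fun z => modulus (f z)) by [].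
by apply/funext => z; exact: modulusN.
Qed.

Fact cfun_mulrnE f n z : (f *+ n) z = f z *+ n.
Proof. by elim: n => [|n IHn]; rewrite ?mulr0n // !mulrS -IHn. Qed.

Fact cfun_normMn f n : cfun_norm (f *+ n) = cfun_norm f *+ n.
Proof.
apply/le_anti/andP; split.
  apply: cfun_norm_le => [|z]; first by rewrite mulrn_wge0 // cfun_norm_ge0.
  by rewrite cfun_mulrnE modulusMn lerMn2r le_cfun_norm orbT.
case: n => [|n]; first by rewrite mulr0n cfun_norm_ge0.
rewrite -mulr_natr -ler_pdivlMr ?ltr0n //.
apply: cfun_norm_le => [|z]; first by rewrite divr_ge0 // cfun_norm_ge0.
rewrite ler_pdivlMr ?ltr0n // mulr_natr -modulusMn -cfun_mulrnE.
exact: le_cfun_norm.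
Qed.

HB.instance Definition _ := Num.Zmodule_isNormed.Build R (cfun R k Z)
  cfun_normD cfun_norm0_eq0 cfun_normMn cfun_normN.

HB.instance Definition _ :=
  PseudoMetric.copy (cfun R k Z) (pseudoMetric_normed (cfun R k Z)).

HB.instance Definition _ := isPointed.Build (cfun R k Z) 0.

HB.instance Definition _ :=
  NormedZmod_PseudoMetric_eq.Build R (cfun R k Z) erefl.

End cfun_norm.

(* Valued in [\bar R], so that an unbounded operator has norm [+oo]. *)
Definition opnorm (R : realType) (V W : normedZmodType R) (T : V -> W) :
    \bar R :=
  ereal_sup [set (`|T v|)%:E | v in [set v : V | `|v| <= 1]].

Definition disjointness_preserving (R : realType) (k : scalar_kind)
    (X Y : compactHausdorffType) (eps : R) (T : cfun R k X -> cfun R k Y) :=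
  [/\ linear T, continuous T
    & forall f g : cfun R k X,
        `|f| = 1 -> `|g| = 1 -> f * g = 0 -> `|T f * T g| <= eps].

Definition weighted_composition (R : realType) (k : scalar_kind)
    (X Y : compactHausdorffType) (S : cfun R k X -> cfun R k Y) :=
  exists (a : cfun R k Y) (h : Y -> X),
    {within [set y | a y != 0], continuous h} /\
    forall f y, S f y = a y * f (h y).

(* [i : D -> Y] is the Stone-Cech compactification of [D], by its universal
   property. *)
Definition stone_cech (D : topologicalType) (Y : compactHausdorffType)
    (i : D -> Y) :=
  continuous i /\
  forall (Z : compactHausdorffType) (f : D -> Z), continuous f ->
    exists! g : Y -> Z, continuous g /\ g \o i = f.

Definition borel (X : ptopologicalType) := g_sigma_algebraType (@open X).

Definition regular_measure (R : realType) (X : ptopologicalType)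
    (mu : set (borel X) -> \bar R) :=
  forall A : set (borel X), measurable A ->
    mu A = ereal_inf [set mu U | U in [set U : set X | open U /\ A `<=` U]] /\
    mu A = ereal_sup [set mu K | K in [set K : set X | compact K /\ K `<=` A]].

Definition atom d (T : measurableType d) (R : realType)
    (mu : set T -> \bar R) (A : set T) :=
  [/\ measurable A, (0 < mu A)%E
    & forall B, measurable B -> B `<=` A -> mu B = 0%E \/ mu (A `\` B) = 0%E].

Definition atomless d (T : measurableType d) (R : realType)
    (mu : set T -> \bar R) := forall A, ~ atom mu A.

(* Main.v *)
Require Import Defs.
From HB Require Import structures.
From mathcomp Require Import all_boot all_order all_algebra.
From mathcomp Require Import complex.
From mathcomp Require Import all_classical all_reals all_analysis.
From mathcomp Require Import ring lra.

(* Fix [y] and let [lam] be the functional [f |-> T f y], with [m] its norm; the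
   point is to find [a] and [x] with [lam] within [2 * sqrt eps] of [f |-> a * f x].
   If [m <= 2 * sqrt eps], take [a = 0].  Otherwise disjointness preservation
   gives [v (m - v) <= eps] for the total variation [v] of [lam] on any open set,
   so that these values avoid an open gap of length
   [g = sqrt (m ^ 2 - 4 eps) > m - 2 * sqrt eps].  If every point had a neighbourhood
   of variation less than [g], the unions along a finite subcover would climb from
   [0] to [m] by steps too short to cross the gap; hence some [x] carries an atom
   of mass at least [g], and removing it leaves at most [m - g].
   The total variation is used only on open sets, where it is a supremum of values
   of [lam], so no representing measure is needed.  One is needed only for the strict
   inequality when [m = 2 * sqrt eps]: if [lam] had no atom, the Caratheodory
   extension of its normalized variation would be an atomless regular probability.
   The universal property of [Y] extends [a] and [x] from the discrete space. *)

Set Implicit Arguments.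
Unset Strict Implicit.
Unset Printing Implicit Defensive.

Import Order.TTheory GRing.Theory Num.Theory.
Import numFieldNormedType.Exports.

Local Open Scope classical_set_scope.
Local Open Scope ring_scope.

(** * Real and complex scalars: modulus and embedding of the reals *)

Section scalars_theory.
Context {R : realType} {k : scalar_kind}.
Implicit Types x y z : scalars R k.

Definition embed : R -> scalars R k :=
  match k return R -> scalars R k with
  | RealScalars => id
  | ComplexScalars => fun r => r%:C%C
  end.

Lemma modulusM x y : modulus (x * y) = modulus x * modulus y.
Proof.
case: k x y => x y; first exact: normrM.
by rewrite /modulus normrM !normc_def /= mul0r subr0.
Qed.

Lemma modulus_embed r : modulus (embed r) = `|r|.
Proof.
rewrite /embed; case: k => //.
by rewrite /modulus normc_def /= expr0n /= addr0 sqrtr_sqr.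
Qed.

Lemma embedB r s : embed (r - s) = embed r - embed s.
Proof. by rewrite /embed; case: k => //; exact: raddfB. Qed.

Lemma embedD r s : embed (r + s) = embed r + embed s.
Proof. by rewrite /embed; case: k => //; exact: raddfD. Qed.

Lemma embedM r s : embed (r * s) = embed r * embed s.
Proof. by rewrite /embed; case: k => //; exact: rmorphM. Qed.

Lemma embed1 : embed 1 = 1.
Proof. by rewrite /embed; case: k. Qed.

Lemma embed0 : embed 0 = 0.
Proof. by rewrite /embed; case: k. Qed.

Lemma modulus1 : modulus (1 : scalars R k) = 1.
Proof. by rewrite -embed1 modulus_embed normr1. Qed.

Lemma modulus_rotation z : exists2 c, modulus c <= 1 & c * z = embed (modulus z).
Proof.
have [->|z0] := eqVneq z 0.
  by exists 0; rewrite ?mulr0 ?modulus0 ?embed0.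
have mz0 : modulus z != 0 by apply: contra_neq z0; exact: modulus0_eq0.
exists (embed (modulus z) / z); last by rewrite divfK.
suff -> : modulus (embed (modulus z) / z) = 1 by [].
apply: (mulIf mz0); rewrite -modulusM divfK // modulus_embed mul1r.
by rewrite ger0_norm // modulus_ge0.
Qed.

Lemma cvg_modulusP (T : Type) (F : set_system T) (FF : Filter F)
    (f : T -> scalars R k) z :
  (forall e : R, 0 < e -> \forall t \near F, modulus (z - f t) < e) -> f @ F --> z.
Proof.
case: k f z => f z fz; apply/cvgrPdist_lt; first exact: fz.
(* A positive [e] in [R[i]] has imaginary part zero, so its real part serves as the radius. *)
move=> e; rewrite ltcE /= => /andP[/eqP Ime0 Ree0].
have := fz _ Ree0; apply: filterS => t zft.
have := normr_ge0 (z - f t); rewrite lecE => /andP[/eqP Im0 _].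
by rewrite ltcE Im0 Ime0 eqxx.
Qed.

Lemma embed_continuous : continuous embed.
Proof.
move=> r; apply: cvg_modulusP => e e0; apply: (nbhs_dist_ltS e0) => s rs.
by rewrite -embedB modulus_embed.
Qed.

End scalars_theory.

(** * Compactness and separation *)

Lemma compact_unit_disc (R : realType) (k : scalar_kind) :
  compact [set z : scalars R k | modulus z <= 1].
Proof.
have cl : closed [set z : scalars R k | modulus z <= 1].
  apply: (@preimage_closed _ _ modulus [set r | r <= 1]); last exact: closed_le.
  by move=> z _; exact: modulus_continuous.
case: k cl => /= cl.
  apply: (subclosed_compact cl (@segment_compact _ (-1) 1)) => r /=.
  by rewrite in_itv /= ler_norml.
pose f (p : R * R) : scalars R ComplexScalars :=
  @embed R ComplexScalars p.1 + 'i%C * @embed R ComplexScalars p.2.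
have ce g : continuous g ->
    continuous (fun p : R * R => @embed R ComplexScalars (g p)).
  by move=> cg p; apply: (@continuous_comp _ _ _ g); [exact: cg|
    exact: embed_continuous].
have cf : continuous f.
  move=> p; apply: (@cvgD (scalars R ComplexScalars)).
    by apply: ce => q; exact: cvg_fst.
  by apply: cvgM; [exact: cvg_cst|apply: ce => q; exact: cvg_snd].
(* The complex disc is a closed part of the image of a compact square under [f]. *)
have : compact (f @` (`[-1, 1] `*` `[-1, 1])).
  apply: continuous_compact; first exact: continuous_subspaceT.
  by apply: compact_setX; exact: segment_compact.
move=> cc; apply: (subclosed_compact cl cc) => z /= z1.
exists (complex.Re z, complex.Im z) => /=; last by rewrite /f /= -complexE.
by split => /=; rewrite in_itv /= -ler_norml; apply: le_trans z1;
  case: (z) => a b /=;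
  rewrite -sqrtr_sqr ler_wsqrtr // ?lerDl ?lerDr sqr_ge0.
Qed.

Lemma compactHausdorff_urysohn (R : realType) (X : compactHausdorffType)
    (A B : set X) :
  closed A -> closed B -> A `&` B = set0 ->
  exists u : X -> R, [/\ continuous u, forall x, 0 <= u x <= 1,
    forall x, A x -> u x = 0 & forall x, B x -> u x = 1].
Proof.
move=> cA cB AB0.
have nX : normal_space X.
  by apply: compact_normal; [exact: hausdorffT|exact: compactT].
have /(@uniform_separatorP _ R)[u [cu u01 u0 u1]] :=
  normal_uniform_separator nX cA cB AB0.
exists u; split => // [x|x Ax|x Bx].
- by have /u01 : range u (u x) by exists x.
- by apply: u0; exists x.
- by apply: u1; exists x.
Qed.

(** Induction along a finite subcover. [P] has to survive only the addition of the neighbourhood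
    chosen at a point, not arbitrary unions; this is what allows climbing by small steps in
    [mass_large_point]. *)
Lemma compact_cover_ind (X : topologicalType) (K : set X) (P : set X -> Prop) :
  compact K -> P set0 ->
  (forall x, K x -> exists2 U, open_nbhs x U &
    forall V, open V -> P V -> P (U `|` V)) ->
  exists V, [/\ open V, K `<=` V & P V].
Proof.
move=> cK P0 KP.
have /choice[U UP] : forall x, exists U, K x ->
    open_nbhs x U /\ forall V, open V -> P V -> P (U `|` V).
  move=> x; have [/KP[U oU UP]|?] := pselect (K x); first by exists U.
  by exists set0.
pose D := [set s : seq X | forall x, x \in s -> K x].
pose B (s : seq X) := \bigcup_(x in [set` s]) U x.
have [s Ds Ks] : exists2 s, D s & K `<=` B s.
  (* Without a finite subcover, the complements in [K] of the finite unions [B s] generate a proper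
     filter; it has a cluster point [x] in [K], which [U x] contradicts. *)
  apply: contrapT => nKB.
  have KB0 s : D s -> K `\` B s !=set0.
    move=> Ds; apply: contrapT => KB; apply: nKB; exists s => // x Kx.
    by apply: contrapT => Bx; apply: KB; exists x.
  have FF : ProperFilter (filter_from D (fun s => K `\` B s)).
    apply: filter_from_proper => //; apply: filter_from_filter.
      by exists [::].
    move=> s t Ds Dt; exists (s ++ t).
      by move=> x; rewrite mem_cat => /orP[]; [exact: Ds|exact: Dt].
    by move=> x [Kx Bx]; split; split => //; apply: contra_not Bx => -[y ys Uy];
      exists y => //=; rewrite mem_cat ys ?orbT.
  have [|x [Kx]] := cK _ FF; first by exists [::] => // x [].
  have Ux : nbhs x (U x) by apply: open_nbhs_nbhs; have [] := UP x Kx.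
  have FU : filter_from D (fun s => K `\` B s) (K `\` U x).
    exists [:: x]; first by move=> y; rewrite inE => /eqP ->.
    by move=> y [Ky By]; split => // Uxy; apply: By; exists x => //=; rewrite inE.
  by move=> /(_ _ _ FU Ux)[y [[_ Uy]]].
have [V [oV sV PV]] : exists V, [/\ open V, B s `<=` V & P V].
  elim: s Ds {Ks} => [_|x s IHs Ds].
    by exists set0; split => //; [exact: open0|move=> y []].
  have [|V [oV sV PV]] := IHs; first by move=> y ys; apply: Ds; rewrite inE ys orbT.
  have [[oU _] UV] := UP x (Ds x (mem_head _ _)).
  exists (U x `|` V); split; [exact: openU|move=> y [z]|exact: UV].
  rewrite /= inE => /orP[/eqP -> ?|zs Uzy]; first by left.
  by right; apply: sV; exists z.
by exists V; split => //; exact: subset_trans sV.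
Qed.

Lemma compactHausdorff_closed_compact (X : compactHausdorffType) (K : set X) :
  closed K -> compact K.
Proof. by move=> cK; apply: (subclosed_compact cK compactT). Qed.

(** * Variation of a functional on open sets *)

Section cfun_theory.
Context {R : realType} {k : scalar_kind} {X : compactHausdorffType}.
Implicit Types f g : cfun R k X.

Fact cfun_embed_subproof (u : X -> R) : continuous u ->
  continuous (fun x => embed (u x) : scalars R k).
Proof.
move=> cu x; apply: (@continuous_comp _ _ _ u); first exact: cu.
exact: embed_continuous.
Qed.

Definition cfun_embed (u : X -> R) (cu : continuous u) : cfun R k X :=
  mkcts (cfun_embed_subproof cu).

Lemma cfun_norm_leP f (r : R) :
  0 <= r -> `|f| <= r <-> forall x, modulus (f x) <= r.
Proof.
move=> r0; split=> [fr x|]; last exact: cfun_norm_le.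
exact: le_trans (le_cfun_norm f x) fr.
Qed.

Lemma modulus_cfun_continuous f : continuous (fun x => modulus (f x)).
Proof.
by move=> x; apply: continuous_comp; [exact: cts_fun|exact: modulus_continuous].
Qed.

Lemma modulus_embedM_le (r : R) (z : scalars R k) :
  0 <= r <= 1 -> modulus (embed r * z) <= modulus z.
Proof.
move=> /andP[r0 r1]; rewrite modulusM modulus_embed ger0_norm //.
by rewrite ler_piMl // modulus_ge0.
Qed.

Lemma cfun_embedME (u : X -> R) (cu : continuous u) f x :
  (cfun_embed cu * f) x = embed (u x) * f x.
Proof. by []. Qed.

Lemma cfun_norm_embedM (u : X -> R) (cu : continuous u) f :
  (forall x, 0 <= u x <= 1) -> `|cfun_embed cu * f| <= `|f|.
Proof.
move=> u01; apply: cfun_norm_le => [|x]; first exact: cfun_norm_ge0.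
exact: le_trans (modulus_embedM_le _ (u01 x)) (le_cfun_norm f x).
Qed.

Lemma cfun_normZ (c : scalars R k) f : `|c *: f| = modulus c * `|f|.
Proof.
have normZ_le (b : scalars R k) g : `|b *: g| <= modulus b * `|g|.
  apply: cfun_norm_le => [|x]; first by rewrite mulr_ge0 ?modulus_ge0.
  by rewrite modulusM ler_wpM2l ?modulus_ge0 // le_cfun_norm.
apply/le_anti; rewrite normZ_le /=.
have [->|c0] := eqVneq c 0; first by rewrite modulus0 mul0r normr_ge0.
have := normZ_le c^-1 (c *: f); rewrite scalerA mulVf // scale1r => cf.
apply: le_trans (ler_wpM2l (modulus_ge0 c) cf) _.
by rewrite mulrA -modulusM mulfV // modulus1 mul1r.
Qed.

Lemma cfun_unit_scaling f : f <> 0 ->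
  exists2 f' : cfun R k X, `|f'| = 1 & f = embed `|f| *: f'.
Proof.
move=> /eqP f0; have f1 : 0 < `|f| by rewrite normr_gt0.
exists (embed `|f|^-1 *: f).
  by rewrite cfun_normZ modulus_embed gtr0_norm ?invr_gt0 // mulVf // gt_eqF.
by rewrite scalerA -embedM mulfV ?gt_eqF // embed1 scale1r.
Qed.

Lemma cfun_scaleM (a b : scalars R k) f g :
  (a *: f) * (b *: g) = (a * b) *: (f * g).
Proof. by apply: cfunP => z; exact: mulrACA. Qed.

End cfun_theory.

Section functional.
Context {R : realType} {k : scalar_kind} {X : compactHausdorffType}.
Implicit Types (f g : cfun R k X) (U V W : set X).
Variables (lam : cfun R k X -> scalars R k) (C : R).
Hypothesis lamP : forall a f g, lam (a *: f + g) = a * lam f + lam g.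
Hypothesis C_ge0 : 0 <= C.
Hypothesis lam_bounded : forall f, modulus (lam f) <= C * `|f|.

Let lam0 : lam 0 = 0.
Proof. by have := lamP (-1) 0 0; rewrite scaler0 addr0 mulN1r addNr. Qed.

Let lamZ a f : lam (a *: f) = a * lam f.
Proof. by have := lamP a f 0; rewrite !addr0 lam0 addr0. Qed.

Let lamD f g : lam (f + g) = lam f + lam g.
Proof. by have := lamP 1 f g; rewrite scale1r mul1r. Qed.

(** Vanishing off [U] lets the support reach the boundary of [U]; [bump_truncation] repairs this
    when a closed carrier is wanted. *)
Definition bump U f := `|f| <= 1 /\ forall x, ~ U x -> f x = 0.

(* For open [U], this is [|mu|(U)], where [mu] is the measure representing [lam]. *)
Definition mass U : R := sup [set modulus (lam f) | f in bump U].

Lemma bump0 U : bump U 0.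
Proof. by split => //; rewrite normr0. Qed.

Lemma bumpS U V f : U `<=` V -> bump U f -> bump V f.
Proof. by move=> UV [f1 fU]; split => // x Vx; apply: fU => /UV. Qed.

Lemma le_mass U f : bump U f -> modulus (lam f) <= mass U.
Proof.
move=> Uf; apply: ub_le_sup; last by exists f.
by exists C => _ [g [g1 _] <-]; apply: le_trans (lam_bounded g) _; rewrite ler_piMr.
Qed.

Lemma mass_le U r :
  (forall f, bump U f -> modulus (lam f) <= r) -> mass U <= r.
Proof.
move=> ubr; apply: ge_sup; first by exists (modulus (lam 0)), 0 => //; exact: bump0.
by move=> _ [f Uf <-]; exact: ubr.
Qed.

Lemma mass_ge0 U : 0 <= mass U.
Proof. exact: le_trans (modulus_ge0 _) (le_mass (bump0 U)). Qed.

Lemma massS U V : U `<=` V -> mass U <= mass V.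
Proof.
by move=> UV; apply: mass_le => f Uf; apply: le_mass; exact: bumpS Uf.
Qed.

Lemma mass0 : mass set0 = 0.
Proof.
apply/le_anti; rewrite mass_ge0 andbT; apply: mass_le => f [_ f0].
by rewrite (_ : f = 0) ?lam0 ?modulus0 //; apply: cfunP => x; exact: f0.
Qed.

(** Cutting [f] off where its modulus is small changes it little in norm, and leaves a function
    carried by a closed set inside [U]. *)
Lemma bump_truncation U f (e : R) : 0 < e -> bump U f ->
  exists g K, [/\ closed K, K `<=` U, bump K g
    & modulus (lam f) <= modulus (lam g) + e].
Proof.
move=> e0 [f1 fU].
(* A change of norm at most [d] moves [lam] by at most [C * d <= e]; the [+ 1] covers [C = 0]. *)
pose d := e / (C + 1).
have C1 : 0 < C + 1 by rewrite ltr_wpDl.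
have d0 : 0 < d by rewrite divr_gt0.
pose A := [set x | modulus (f x) <= d / 2]; pose B := [set x | d <= modulus (f x)].
have cm := @modulus_cfun_continuous _ _ _ f.
have cA : closed A.
  by apply: (@preimage_closed _ _ _ [set r | r <= d / 2]) => //; exact: closed_le.
have cB : closed B.
  by apply: (@preimage_closed _ _ _ [set r | d <= r]) => //; exact: closed_ge.
have AB0 : A `&` B = set0.
  rewrite -subset0 => x [/= Ax Bx].
  by have := le_trans Bx Ax; lra.
have [u [cu u01 u0 u1]] := compactHausdorff_urysohn R cA cB AB0.
exists (cfun_embed cu * f), [set x | d / 2 <= modulus (f x)]; split.
- by apply: (@preimage_closed _ _ _ [set r | d / 2 <= r]) => //; exact: closed_ge.
- move=> x /= fx; apply: contrapT => /fU fx0.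
  by move: fx; rewrite fx0 modulus0 leNgt divr_gt0.
- split; first exact: le_trans (cfun_norm_embedM _ _ u01) f1.
  move=> x /= /negP; rewrite -ltNge => /ltW fx.
  by rewrite cfun_embedME u0 // embed0 mul0r.
have dfg : `|f - cfun_embed cu * f| <= d.
  apply/cfun_norm_leP; first exact: ltW.
  move=> x; rewrite (_ : _ x = embed (1 - u x) * f x); last first.
    by rewrite embedB embed1 mulrBl mul1r.
  have [fxd|xd] := leP d (modulus (f x)).
    by rewrite u1 // subrr embed0 mul0r modulus0 ltW.
  apply: le_trans (ltW xd); apply: modulus_embedM_le.
  by rewrite subr_ge0 lerBlDr lerDl andbC; exact: u01.
rewrite -{1}(subrK (cfun_embed cu * f) f) lamD addrC.
apply: le_trans (modulusD _ _) _; rewrite lerD2l.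
apply: le_trans (lam_bounded _) _.
apply: le_trans (ler_wpM2l C_ge0 dfg) _.
by rewrite /d mulrCA ler_piMr ?(ltW e0) // ler_pdivrMr // mul1r lerDl.
Qed.

(** Truncate to [g] carried by a closed [K], and take [u] equal to 0 off [U] and to 1 on [K] outside
    [V]. Then [u * g] is a bump in [U] and [(1 - u) * g] is one in [V]. *)
Lemma mass_setU U V : open U -> open V ->
  mass (U `|` V) <= mass U + mass V.
Proof.
move=> oU oV; apply: mass_le => f UVf; apply/ler_addgt0Pr => e e0.
have [g [K [cK KUV [g1 gK] fg]]] := bump_truncation e0 UVf.
apply: le_trans fg _; rewrite lerD2r.
have cA : closed (~` U) by exact: open_closedC.
have cB : closed (K `\` V) by apply: closedI => //; exact: open_closedC.
have AB0 : ~` U `&` (K `\` V) = set0.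
  by rewrite -subset0 => x [/= Ux [/KUV [|]]].
have [u [cu u01 u0 u1]] := compactHausdorff_urysohn R cA cB AB0.
have cv : continuous (fun x => 1 - u x).
  by move=> x; apply: cvgB; [exact: cvg_cst|exact: cu].
have v01 x : 0 <= 1 - u x <= 1 by have /andP[? ?] := u01 x; apply/andP; lra.
have -> : g = cfun_embed cu * g + cfun_embed cv * g.
  apply: cfunP => x; change (g x = embed (u x) * g x + embed (1 - u x) * g x).
  by rewrite embedB embed1; ring.
rewrite lamD; apply: le_trans (modulusD _ _) _; apply: lerD; apply: le_mass.
  split; first exact: le_trans (cfun_norm_embedM _ _ u01) g1.
  by move=> x Ux; rewrite cfun_embedME u0 // embed0 mul0r.
split; first exact: le_trans (cfun_norm_embedM _ _ v01) g1.
move=> x Vx; have [Kx|Kx] := pselect (K x); last by rewrite cfun_embedME gK // mulr0.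
by rewrite cfun_embedME u1 // subrr embed0 mul0r.
Qed.

(** Rotating the phases makes both values of [lam] nonnegative reals, so they add up without
    cancellation; as [f * g = 0], the sum of the rotated functions stays in the unit ball. *)
Lemma bump_disjoint U f g : bump U f -> bump U g -> f * g = 0 ->
  modulus (lam f) + modulus (lam g) <= mass U.
Proof.
move=> [f1 fU] [g1 gU] fg0.
have [c c1 cf] := modulus_rotation (lam f).
have [d d1 dg] := modulus_rotation (lam g).
have h0 : 0 <= modulus (lam f) + modulus (lam g) by rewrite addr_ge0 ?modulus_ge0.
rewrite -[X in X <= _](ger0_norm h0) -(@modulus_embed R k) embedD.
rewrite -cf -dg -!lamZ -lamD.
apply: le_mass; split; last first.
  by move=> x Ux; change (c * f x + d * g x = 0); rewrite fU // gU // !mulr0 addr0.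
apply/cfun_norm_leP => // x.
have fx1 : modulus (c * f x) <= 1.
  by rewrite modulusM mulr_ile1 ?modulus_ge0 // (le_trans (le_cfun_norm f x)).
have gx1 : modulus (d * g x) <= 1.
  by rewrite modulusM mulr_ile1 ?modulus_ge0 // (le_trans (le_cfun_norm g x)).
have : f x * g x = 0 by exact: (congr1 (fun h : cfun R k X => h x) fg0).
change (f x * g x = 0 -> modulus (c * f x + d * g x) <= 1).
by move=> /eqP; rewrite mulf_eq0 => /orP[] /eqP ->; rewrite mulr0 ?add0r ?addr0.
Qed.

(** The superadditive counterpart of [mass_setU]: [f] and any bump in the rest of [U] have product
    zero. *)
Lemma mass_setD U K f : K `<=` U -> bump K f ->
  modulus (lam f) + mass (U `\` K) <= mass U.
Proof.
move=> KU Kf; rewrite -lerBrDl; apply: mass_le => g Ug.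
rewrite lerBrDl; apply: bump_disjoint.
- exact: bumpS Kf.
- by apply: bumpS Ug => x [].
- apply: cfunP => x; have [Kx|Kx] := pselect (K x).
    by change (f x * g x = 0); rewrite (_ : g x = 0) ?mulr0 //; apply: (Ug.2) => -[].
  by change (f x * g x = 0); rewrite (_ : f x = 0) ?mul0r //; exact: (Kf.2).
Qed.

(** A truncated bump lives on a compact set, which finitely many [U n] cover, so finite
    subadditivity suffices. *)
Lemma mass_bigcup (U : (set X)^nat) : (forall n, open (U n)) ->
  ((mass (\bigcup_n U n))%:E <= \sum_(n <oo) (mass (U n))%:E)%E.
Proof.
move=> oU; set S := (X in (_ <= X)%E).
have bS N : ((mass (\bigcup_(n in `I_N) U n))%:E <= S)%E.
  apply: (@le_trans _ _ (\sum_(0 <= n < N) (mass (U n))%:E)%E); last first.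
    by apply: nneseries_lim_ge => n _ _; rewrite lee_fin mass_ge0.
  rewrite sumEFin lee_fin; elim: N => [|N IHN].
    by rewrite II0 bigcup_set0 mass0 big_geq.
  rewrite big_nat_recr //= IIS bigcup_setU bigcup_set1.
  apply: le_trans (lerD IHN (lexx _)); apply: mass_setU => //.
  by apply: bigcup_open => n _; exact: oU.
have : (0 <= S)%E by apply: nneseries_ge0 => n _ _; rewrite lee_fin mass_ge0.
move: S bS => [s bS s0|_ _|_ //]; last by rewrite leey.
rewrite lee_fin; apply: mass_le => f Uf; apply/ler_addgt0Pr => e e0.
have [g [K [cK KU Kg fg]]] := bump_truncation e0 Uf.
apply: le_trans fg _; rewrite lerD2r.
have [V [_ KV [N VN]]] : exists V, [/\ open V, K `<=` V &
    exists N, V `<=` \bigcup_(n in `I_N) U n].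
  apply: compact_cover_ind; first exact: compactHausdorff_closed_compact.
    by exists 0.
  move=> x /KU[n _ Unx]; exists (U n) => // V oV [N VN].
  (* The index set [I_N] stops before [N], hence [n.+1] to include [n]. *)
  exists (maxn n.+1 N) => y [Uny|/VN[i /= iN Uiy]].
    by exists n => //=; rewrite leq_max leqnn.
  by exists i => //=; rewrite leq_max iN orbT.
rewrite -lee_fin; apply: le_trans (bS N); rewrite lee_fin.
by apply: le_mass; apply: bumpS Kg; exact: subset_trans VN.
Qed.

(** [W] is the complement of the closed carrier of a truncation of [f]. This yields the disjoint
    pairs to which the hypothesis on [eps] applies in [mass_gap]. *)
Lemma mass_split U f : open U -> bump U f ->
  forall e, 0 < e -> exists g W, [/\ open W, U `|` W = setT, bump U g,
    forall h, bump W h -> g * h = 0 & modulus (lam f) <= modulus (lam g) + e].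
Proof.
move=> oU Uf e e0; have [g [K [cK KU Kg fg]]] := bump_truncation e0 Uf.
exists g, (~` K); split => //.
- exact: closed_openC.
- rewrite -subTset => x _; have [/KU|] := pselect (K x); by [left|right].
- exact: bumpS Kg.
- move=> h [_ h0]; apply: cfunP => x.
  change (g x * h x = 0); have [Kx|Kx] := pselect (K x).
    by rewrite h0 ?mulr0 //; exact.
  by rewrite Kg.2 ?mul0r.
Qed.

(** With [g] and [W] from [mass_split], the mass of [W] is at least [mass setT - mass U]. Taking
    suprema in the product bound, first over the bumps in [W] and then over those in [U], gives the
    claim. *)
Lemma mass_gap (eps : R) : 0 < eps ->
  (forall f g, `|f| <= 1 -> `|g| <= 1 -> f * g = 0 ->
    modulus (lam f) * modulus (lam g) <= eps) ->
  forall U, open U -> mass U * (mass setT - mass U) <= eps.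
Proof.
move=> eps0 dp U oU.
have d0 : 0 <= mass setT - mass U by rewrite subr_ge0 massS.
have fd f : bump U f -> modulus (lam f) * (mass setT - mass U) <= eps.
  move=> Uf; apply/ler_addgt0Pr => e e0.
  (* Chosen so that an error [d] in [lam], multiplied by [mass setT - mass U], costs at most [e]. *)
  pose d := e / (mass setT - mass U + 1).
  have p0 : 0 < mass setT - mass U + 1 by rewrite ltr_wpDl.
  have dd0 : 0 < d by rewrite divr_gt0.
  have [g [W [oW UW Ug gW fg]]] := mass_split oU Uf dd0.
  apply: le_trans (ler_wpM2r d0 fg) _; rewrite mulrDl; apply: lerD; last first.
    by rewrite /d mulrAC ler_pdivrMr // ler_wpM2l ?(ltW e0) // lerDl.
  have VW : mass setT - mass U <= mass W.
    by rewrite lerBlDl -UW; exact: mass_setU.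
  apply: le_trans (ler_wpM2l (modulus_ge0 _) VW) _.
  have [->|g0] := eqVneq (modulus (lam g)) 0; first by rewrite mul0r ltW.
  have gp : 0 < modulus (lam g) by rewrite lt_neqAle eq_sym g0 modulus_ge0.
  rewrite mulrC -ler_pdivlMr //; apply: mass_le => h Wh.
  by rewrite ler_pdivlMr // mulrC; apply: dp; [exact: Ug.1|exact: Wh.1|exact: gW].
have [->|dn0] := eqVneq (mass setT - mass U) 0; first by rewrite mulr0 ltW.
have dp0 : 0 < mass setT - mass U by rewrite lt_neqAle eq_sym dn0.
by rewrite -ler_pdivlMr //; apply: mass_le => f /fd; rewrite ler_pdivlMr.
Qed.

(* Open sets miss the gap [((m - g) / 2, (m + g) / 2)] of masses, so a
   cover by open sets of mass less than [g] could never exhaust [X]. *)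
Lemma mass_large_point (eps : R) : 0 < eps ->
  (forall f g, `|f| <= 1 -> `|g| <= 1 -> f * g = 0 ->
    modulus (lam f) * modulus (lam g) <= eps) ->
  2 * Num.sqrt eps < mass setT ->
  exists2 p, mass setT - 2 * Num.sqrt eps < p &
    exists x, forall U, open_nbhs x U -> p <= mass U.
Proof.
move=> eps0 dp; set m := mass setT => me.
set s := Num.sqrt eps in me *.
have s0 : 0 < s by rewrite sqrtr_gt0.
have ss : s ^+ 2 = eps by rewrite sqr_sqrtr // ltW.
(* The roots of [v * (m - v) = eps] are [(m - g) / 2] and [(m + g) / 2]. *)
set g := Num.sqrt (m ^+ 2 - 4 * eps).
have gg : g ^+ 2 = m ^+ 2 - 4 * eps by rewrite sqr_sqrtr //; nra.
have g0 : 0 <= g by exact: sqrtr_ge0.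
have gp : 0 < g by rewrite sqrtr_gt0; nra.
(* Here [g ^ 2 - (m - 2 * s) ^ 2 = 4 * s * (m - 2 * s)] is positive. *)
exists g; first by nra.
apply: contrapT => /forallNP gN.
have [V [oV VT PV]] : exists V, [/\ open V, [set: X] `<=` V & 2 * mass V <= m - g].
  apply: compact_cover_ind; first exact: compactT.
    rewrite mass0; nra.
  move=> x _; have /existsNP[U /not_implyP[xU /negP]] := gN x.
  rewrite -ltNge => Ug; exists U => // V oV PV.
  have oUV : open (U `|` V) by apply: openU => //; exact: xU.1.
  have := mass_gap eps0 dp oUV; have := mass_setU xU.1 oV.
  rewrite -/m; set v := mass (_ `|` _) => vUV vgap.
  (* Adding a mass below [g] to one of at most [(m - g) / 2] stays below the upper end of the gap,
     so the gap pushes [v] back to its lower end. *)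
  have : v < (m + g) / 2 by lra.
  move=> vm; nra.
have : mass V = m by congr mass; rewrite -subTset.
by move=> Vm; move: PV; rewrite Vm; lra.
Qed.

(** A truncated bump is carried by a closed [K] missing [x]; what is left of [U] is still a
    neighbourhood of [x], of mass at least [p], and [mass_setD] adds the two. *)
Lemma mass_setD1 U x p : open_nbhs x U ->
  (forall V, open_nbhs x V -> p <= mass V) ->
  mass (U `\ x) <= mass U - p.
Proof.
move=> [oU Ux] xp; apply: mass_le => f Uf; apply/ler_addgt0Pr => e e0.
have [g [K [cK KU Kg fg]]] := bump_truncation e0 Uf.
have KsU : K `<=` U by move=> y /KU[].
apply: le_trans fg _; rewrite lerD2r lerBrDr.
apply: le_trans (mass_setD KsU Kg); rewrite lerD2l; apply: xp; split.
  by apply: openI => //; exact: closed_openC.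
by split => // /KU[_]; exact.
Qed.

(** The weight is [lam u] for a Urysohn function [u] with [u x = 1], vanishing off a neighbourhood
    [U] of nearly minimal mass. In [f = (1 - u) f + u (f - f x) + (f x) u] the first two terms
    vanish at [x], so the atom does not see them, and the last contributes [a * f x]. *)
Lemma functional_near_evaluation x p c :
  (forall U, open_nbhs x U -> p <= mass U) -> mass setT - p < c ->
  exists2 a, modulus a <= mass setT &
    forall f, `|f| <= 1 -> modulus (lam f - a * f x) <= c.
Proof.
move=> xp mpc.
pose S := [set mass U | U in open_nbhs x].
have oT : open_nbhs x [set: X] by split => //; exact: openT.
have S0 : S !=set0 by exists (mass setT), setT.
have lS : has_lbound S by exists p => _ [U xU <-]; exact: xp.
(* The mass of the atom at [x], of which [p] is only a lower bound. *)
pose q := inf S.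
have xq U : open_nbhs x U -> q <= mass U.
  by move=> xU; apply: ge_inf => //; exists U.
have pq : p <= q by apply: lb_le_inf => // _ [U xU <-]; exact: xp.
(* Half the slack, so that the two error terms, at most [mass setT - q] and [2 * e], add up to at
   most [c]. *)
pose e := (c - (mass setT - p)) / 2.
have e0 : 0 < e by rewrite divr_gt0 // subr_gt0.
have [_ [U xU <-] Uq] := inf_adherent e0 (conj S0 lS).
have cU : closed (~` U) by apply: open_closedC; exact: xU.1.
have c1 : closed [set x].
  by apply: compact_closed; [exact: hausdorffT|exact: compact_set1].
have Ux0 : ~` U `&` [set x] = set0.
  by rewrite -subset0 => y [/= Uy yx]; apply: Uy; rewrite yx; exact: xU.2.
have [u [cu u01 u0 u1]] := compactHausdorff_urysohn R cU c1 Ux0.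
have cv : continuous (fun x => 1 - u x).
  by move=> y; apply: cvgB; [exact: cvg_cst|exact: cu].
have v01 y : 0 <= 1 - u y <= 1 by have /andP[? ?] := u01 y; apply/andP; lra.
have uU : bump U (cfun_embed cu).
  split; last first.
    by move=> y Uy; change (embed (u y) = 0 :> scalars R k); rewrite u0 // embed0.
  apply/cfun_norm_leP => // y; change (modulus (embed (u y) : scalars R k) <= 1).
  by rewrite modulus_embed; have /andP[? ?] := u01 y; rewrite ger0_norm.
exists (lam (cfun_embed cu)).
  by apply: le_trans (le_mass uU) _; exact: massS.
move=> f f1.
pose fx : scalars R k := f x.
pose h : cfun R k X := f - cfun_const fx.
have hE y : h y = f y - fx by [].
have fE : f = cfun_embed cv * f + (cfun_embed cu * h + fx *: cfun_embed cu).
  apply: cfunP => y.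
  change (f y = embed (1 - u y) * f y + (embed (u y) * h y + fx * embed (u y))).
  by rewrite hE embedB embed1; ring.
rewrite [in X in X - _]fE lamD lamD lamZ -/fx (mulrC _ fx) -!addrA subrr addr0.
apply: le_trans (modulusD _ _) _.
have b1 : modulus (lam (cfun_embed cv * f)) <= mass setT - q.
  apply: (@le_trans _ _ (mass (setT `\ x))); last exact: mass_setD1.
  apply: le_mass; split.
    exact: le_trans (cfun_norm_embedM _ _ v01) f1.
  move=> y yx; have -> : y = x by apply: contrapT => ?; exact: yx.
  by rewrite cfun_embedME u1 // subrr embed0 mul0r.
have b2 : modulus (lam (cfun_embed cu * h)) <= 2 * e.
  have half0 : 0 < 2^-1 :> R by rewrite invr_gt0.
  (* [f - f x] may have norm 2, hence the factor one half. *)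
  have bh : bump (U `\ x) (embed 2^-1 *: (cfun_embed cu * h)).
    split; last first.
      move=> y Uy; change (embed 2^-1 * (embed (u y) * h y) = 0).
      have [->|yx] := pselect (y = x); first by rewrite hE subrr !mulr0.
      by rewrite u0 ?embed0 ?mul0r ?mulr0 // => Uy'; exact: Uy.
    rewrite cfun_normZ modulus_embed gtr0_norm // ler_pdivrMl // mulr1.
    apply: le_trans (cfun_norm_embedM _ _ u01) _.
    apply/cfun_norm_leP => // y; rewrite hE; apply: le_trans (modulusD _ _) _.
    rewrite modulusN (_ : 2 = 1 + 1) //; apply: lerD;
      exact: le_trans (le_cfun_norm f _) f1.
  have := le_trans (le_mass bh) (mass_setD1 xU xq).
  by rewrite lamZ modulusM modulus_embed gtr0_norm // -/q in Uq *; lra.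
by rewrite /e in b2; lra.
Qed.

End functional.

(** * The regular measure of a functional without atoms *)

Section mass_measure.
Context {R : realType} {k : scalar_kind} {X : pcompactHausdorffType}.
Implicit Types (f g : cfun R k X) (U V A : set X).
Variables (lam : cfun R k X -> scalars R k) (C : R).
Hypothesis lamP : forall a f g, lam (a *: f + g) = a * lam f + lam g.
Hypothesis C_ge0 : 0 <= C.
Hypothesis lam_bounded : forall f, modulus (lam f) <= C * `|f|.

Let var := mass lam.

(** The outer measure induced by the masses of open sets, which makes outer regularity automatic. *)
Definition outer_mass A : R :=
  inf [set mass lam U | U in [set U | open U /\ A `<=` U]].

Let ov := outer_mass.

Let nbhd_ne A : [set mass lam U | U in [set U | open U /\ A `<=` U]] !=set0.
Proof. by exists (var setT), setT => //; split => //; exact: openT. Qed.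

Let nbhd_lb A : has_lbound [set mass lam U | U in [set U | open U /\ A `<=` U]].
Proof. by exists 0 => _ [U _ <-]; exact: (mass_ge0 C_ge0 lam_bounded). Qed.

Let ov_ge0 A : 0 <= ov A.
Proof.
apply: (lb_le_inf (nbhd_ne A)) => _ [U _ <-]; exact: (mass_ge0 C_ge0 lam_bounded).
Qed.

Let ov_le A U : open U -> A `<=` U -> ov A <= var U.
Proof. by move=> oU AU; apply: ge_inf; [exact: nbhd_lb|exists U]. Qed.

Let ov_adherent A (e : R) : 0 < e ->
  exists U, [/\ open U, A `<=` U & var U <= ov A + e].
Proof.
move=> e0; have [_ [U [oU AU] <-] Ue] :=
  inf_adherent e0 (conj (nbhd_ne A) (nbhd_lb A)).
by exists U; split => //; exact: ltW.
Qed.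

Let ovS A B : A `<=` B -> ov A <= ov B.
Proof.
move=> AB; apply/ler_addgt0Pr => e e0; have [U [oU BU]] := ov_adherent B e0.
by apply: le_trans; apply: ov_le => //; exact: subset_trans BU.
Qed.

Let ov_open U : open U -> ov U = var U.
Proof.
move=> oU; apply/le_anti/andP; split; first exact: ov_le.
apply/ler_addgt0Pr => e e0; have [V [oV UV Ve]] := ov_adherent U e0.
exact: le_trans (massS C_ge0 lam_bounded UV) Ve.
Qed.

Let ov_set0 : ov set0 = 0.
Proof. by rewrite ov_open; [exact: (mass0 lamP C_ge0 lam_bounded)|exact: open0]. Qed.

Let ov_bigcup (A : (set X)^nat) :
  ((ov (\bigcup_n A n))%:E <= \sum_(n <oo) (ov (A n))%:E)%E.
Proof.
apply/lee_addgt0Pr => e e0.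
have /choice[U UP] n : exists U, [/\ open U, A n `<=` U &
    var U <= ov (A n) + e / (2 ^ n.+1)%:R].
  by apply: ov_adherent; rewrite divr_gt0 // ltr0n expn_gt0.
apply: le_trans (epsilon_trick _ _ (ltW e0)); last first.
  by move=> n; rewrite lee_fin ov_ge0.
apply: (@le_trans _ _ (var (\bigcup_n U n))%:E).
  rewrite lee_fin; apply: ov_le; first by apply: bigcup_open => n _; have [] := UP n.
  by apply: subset_bigcup => n _; have [] := UP n.
apply: (le_trans (mass_bigcup lamP C_ge0 lam_bounded _)).
  by move=> n; have [] := UP n.
apply: lee_nneseries => n _; rewrite ?lee_fin ?(mass_ge0 C_ge0 lam_bounded) //.
by have [] := UP n.
Qed.

Let ov_setU A B : ov (A `|` B) <= ov A + ov B.
Proof.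
apply/ler_addgt0Pr => e e0.
have e20 : 0 < e / 2 by rewrite divr_gt0.
have [U [oU AU Ue]] := ov_adherent A e20.
have [V [oV BV Ve]] := ov_adherent B e20.
apply: (@le_trans _ _ (var (U `|` V))).
  by apply: ov_le; [exact: openU|exact: setUSS].
apply: le_trans (mass_setU lamP C_ge0 lam_bounded oU oV) _.
by rewrite -/var; lra.
Qed.

(** For an open [V] containing [A], truncate a bump in the part of [V] inside [U] to a closed [K].
    The rest of [V] is an open set containing the part of [A] outside [U], and [mass_setD]
    applies. *)
Let ov_caratheodory U A : open U -> ov (A `&` U) + ov (A `&` ~` U) <= ov A.
Proof.
move=> oU; apply/ler_addgt0Pr => e e0.
have e20 : 0 < e / 2 by rewrite divr_gt0.
have [V [oV AV Ve]] := ov_adherent A e20.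
suff : var (V `&` U) <= var V - ov (A `&` ~` U) + e / 2.
  have : ov (A `&` U) <= var (V `&` U) by apply: ov_le; [exact: openI|exact: setSI].
  by lra.
apply: mass_le => f VUf.
have [g [K [cK KVU Kg fg]]] := bump_truncation lamP C_ge0 lam_bounded e20 VUf.
apply: le_trans fg _; rewrite lerD2r lerBrDr.
have KV : K `<=` V by move=> x /KVU[].
apply: le_trans (mass_setD lamP C_ge0 lam_bounded KV Kg).
rewrite lerD2l; apply: ov_le; first by apply: openI => //; exact: closed_openC.
by move=> x [Ax Ux]; split; [exact: AV|move=> /KVU[]].
Qed.

Let mu A : \bar R := (ov A)%:E.

Hypothesis mass_setT1 : mass lam setT = 1.
Hypothesis small_nbhds : forall x (e : R), 0 < e ->
  exists2 U, open_nbhs x U & mass lam U < e.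

Lemma exists_regular_atomless_probability :
  exists mu : probability (borel X) R, regular_measure mu /\ atomless mu.
Proof.
have mu_subadd : sigma_subadditive mu by move=> A; exact: ov_bigcup.
pose om : {outer_measure set X -> \bar R} := HB.pack_for (outer_measure R X) mu
  (isOuterMeasure.Build R X mu (congr1 EFin ov_set0)
    (fun A => (ov_ge0 A : (0 <= mu A)%E))
    (fun A B AB => (ovS AB : (mu A <= mu B)%E)) mu_subadd).
(* The Caratheodory measurable sets form a sigma-algebra containing the open sets. *)
have om_borel (A : set (borel X)) : measurable A -> om.-caratheodory A.
  apply: smallest_sub.
    exact: (@sigma_algebra_measurable _ (caratheodory_type om)).
  move=> U oU; apply: le_caratheodory_measurable => Z.
  by rewrite -EFinD lee_fin; exact: ov_caratheodory.
have mu_sigma : semi_sigma_additive (mu : set (borel X) -> \bar R).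
  move=> F mF tF mUF.
  apply: (@caratheodory_measure_sigma_additive _ _ om F) => //.
    by move=> n; exact: om_borel.
  exact: om_borel.
pose nu : {measure set (borel X) -> \bar R} :=
  HB.pack_for {measure set (borel X) -> \bar R} (mu : set (borel X) -> \bar R)
  (isMeasure.Build _ (borel X) R mu (congr1 EFin ov_set0)
    (fun A => (ov_ge0 A : (0 <= mu A)%E)) mu_sigma).
have ovT : ov [set: X] = 1 by rewrite ov_open //; exact: openT.
have nuT : nu setT = 1%E by exact: (congr1 EFin ovT).
pose P : probability (borel X) R := HB.pack_for (probability (borel X) R)
  (mu : set (borel X) -> \bar R) nu
  (Measure_isProbability.Build _ _ _ nu nuT).
(* As the total mass is 1, outer approximation of a complement becomes inner approximation by closed
   sets. *)
have ovC (A : set (borel X)) : measurable A -> ov A + ov (~` A) = 1.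
  move=> mA; have := om_borel A mA setT; rewrite !setTI -EFinD => -[] <-.
  exact: ovT.
have open_measurable (U : set (borel X)) : open (U : set X) -> measurable U.
  by move=> oU; exact: sub_sigma_algebra.
have inner (A : set (borel X)) (e : R) : measurable A -> 0 < e ->
    exists K : set X, [/\ closed K, K `<=` A & ov A <= ov K + e].
  move=> mA e0; have [U [oU AU Ue]] := ov_adherent (~` A) e0.
  exists (~` U); split; first exact: open_closedC.
    by rewrite -[A]setCK; exact: subsetC.
  have := ovC A mA; have := ovC U (open_measurable U oU); rewrite (ov_open oU).
  lra.
exists P; split.
  move=> A mA; split; apply/le_anti/andP; split.
  - by apply: le_ereal_inf_tmp => _ [U [oU AU] <-]; rewrite lee_fin; exact: ovS.
  - apply/lee_addgt0Pr => e e0; have [U [oU AU Ue]] := ov_adherent A e0.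
    apply: (@le_trans _ _ (mu U)); first by apply: ereal_inf_lbound; exists U.
    by rewrite -EFinD lee_fin ov_open.
  - apply/lee_addgt0Pr => e e0; have [K [cK KA Ke]] := inner A e mA e0.
    apply: (@le_trans _ _ (mu K + e%:E)%E); first by rewrite -EFinD lee_fin.
    apply: leeD2r; apply: ereal_sup_ubound; exists K => //; split => //.
    exact: compactHausdorff_closed_compact.
  - by apply: ge_ereal_sup => _ [K [_ KA] <-]; rewrite lee_fin; exact: ovS.
move=> A [mA A0 Aatom]; have {A0} A0 : 0 < ov A by rewrite -lte_fin.
have [K [cK KA KA2]] := inner A (ov A / 2) mA (divr_gt0 A0 (ltr0n _ 2)).
(* Every point has a neighbourhood lighter than the atom [A], which therefore meets [A] in a null
   set. Finitely many of them cover [K], making [K] null although it carries at least half the mass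
   of [A]. *)
have [V [_ KV AV0]] : exists V, [/\ open V, K `<=` V & ov (A `&` V) = 0].
  apply: compact_cover_ind; first exact: compactHausdorff_closed_compact.
    by rewrite setI0.
  move=> x _; have [U xU UA] := small_nbhds x A0; exists U => // V oV AV0.
  apply/le_anti; rewrite ov_ge0 andbT setIUr.
  apply: le_trans (ov_setU _ _) _; rewrite AV0 addr0.
  have mAU : measurable (A `&` U : set (borel X)).
    by apply: measurableI => //; apply: open_measurable; exact: xU.1.
  have [[->]//|[AU0]] := Aatom _ mAU (@subIsetl _ _ _).
  suff : ov A <= ov U by rewrite (ov_open xU.1) leNgt UA.
  apply: le_trans (_ : _ <= ov (A `\` (A `&` U)) + ov U) _; last first.
    by rewrite [X in X + _]AU0 add0r.
  apply: le_trans (ov_setU _ _); apply: ovS => y Ay.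
  by have [Uy|Uy] := pselect (U y); [right|left; split => // -[]].
have : ov K <= ov (A `&` V) by apply: ovS => y Ky; split; [exact: KA|exact: KV].
by rewrite AV0; lra.
Qed.

End mass_measure.

(** * Approximation by weighted evaluations *)

Section subspace_compactHausdorff.
Context {X : topologicalType} (A : set X).

(** The universal property in [stone_cech] ranges over types, so compact target sets are turned into
    compact Hausdorff types. *)
Lemma set_type_compact : compact A -> compact [set: set_type A].
Proof.
move=> cA F FF _.
have [|p [Ap pF]] := cA (set_val @ F) (fmap_proper_filter _ FF).
  by apply: (@filterS _ F _ setT) => [x _|]; [exact: set_valP|exact: filterT].
exists (exist _ p (mem_set Ap)); split => // B C FB.
rewrite nbhsE => -[_ [[W oW <-] Wp] WC].
have [|_ [[x Bx <-] Wx]] := pF (set_val @` B) W _ (open_nbhs_nbhs (conj oW Wp)).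
  by apply: (@filterS _ F _ B) => // x Bx; exists x.
by exists x; split => //; exact: WC.
Qed.

Lemma set_type_hausdorff : hausdorff_space X -> hausdorff_space (set_type A).
Proof.
move=> hX p q pq; apply: val_inj; apply: hX => B C Bp Cq.
have [||x [Bx Cx]] := pq (set_val @^-1` B) (set_val @^-1` C).
- exact: (@initial_continuous _ _ set_val).
- exact: (@initial_continuous _ _ set_val).
- by exists (set_val x).
Qed.

End subspace_compactHausdorff.

Lemma scalars_hausdorff (R : realType) (k : scalar_kind) :
  hausdorff_space (scalars R k).
Proof. exact: (@norm_hausdorff (scalars R k) (scalars R k)). Qed.

(** * Extension from the discrete space to its compactification *)

Section stone_cech_theory.
Context {D : discreteTopologicalType} {Y : compactHausdorffType} {i : D -> Y}.
Hypothesis iP : stone_cech i.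

Lemma discrete_continuous (Z : topologicalType) (f : D -> Z) : continuous f.
Proof.
move=> d B fB; apply: open_nbhs_nbhs; split; first exact: discrete_open.
exact: (nbhs_singleton fB).
Qed.

Lemma stone_cech_compact_extension (Z : topologicalType) (B : set Z) (f : D -> Z) :
  hausdorff_space Z -> compact B -> (forall d, B (f d)) ->
  exists g : Y -> Z, continuous g /\ forall d, g (i d) = f d.
Proof.
move=> hZ cB fB.
pose Z' : compactHausdorffType := HB.pack_for compactHausdorffType (set_type B)
  (isCompactHausdorff.Build (set_type B) (set_type_compact cB)
    (set_type_hausdorff hZ)).
pose f' (d : D) : Z' := exist _ (f d) (mem_set (fB d)).
have [g [[cg gf] _]] := iP.2 Z' f' (@discrete_continuous _ f').
exists (fun y => set_val (g y : set_type B)); split; last first.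
  by move=> d; have := congr1 (fun h => set_val (h d : set_type B)) gf.
move=> y; apply: (@continuous_comp _ _ _ g); first exact: cg.
exact: (@initial_continuous _ _ set_val).
Qed.

(** Uniqueness of extensions gives density: a Urysohn function vanishing on [B] and equal to 1 at a
    point [y] outside [B] would extend the same map into [[0, 1]] as the constant 0. *)
Lemma stone_cech_dense (R : realType) (B : set Y) :
  closed B -> (forall d, B (i d)) -> forall y, B y.
Proof.
move=> cB iB y; apply: contrapT => By.
have cy : closed [set y].
  by apply: compact_closed; [exact: hausdorffT|exact: compact_set1].
have By0 : B `&` [set y] = set0.
  by rewrite -subset0 => z [Bz zy]; apply: By; rewrite -zy.
have [u [cu u01 u0 u1]] := compactHausdorff_urysohn R cB cy By0.
pose J : set R := [set` `[0 : R, 1]].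
have hR : hausdorff_space R by exact: (@norm_hausdorff R R).
pose Z' : compactHausdorffType := HB.pack_for compactHausdorffType (set_type J)
  (isCompactHausdorff.Build (set_type J) (set_type_compact (@segment_compact R 0 1))
    (set_type_hausdorff hR)).
have J0 : J 0 by rewrite /J /= in_itv /= lexx ler01.
have Ju z : J (u z) by rewrite /J /= in_itv /=; exact: u01.
pose z0 : Z' := exist _ 0 (mem_set J0).
pose g (z : Y) : Z' := exist _ (u z) (mem_set (Ju z)).
have cg : continuous g by apply/continuous_comp_initial.
have cc : continuous (fun _ : D => z0) by exact: cst_continuous.
have [g' [_ g'U]] := iP.2 Z' _ cc.
have E1 : g' = (fun _ => z0) by apply: g'U; split => //; exact: cst_continuous.
have E2 : g' = g.
  apply: g'U; split => //; apply/funext => d; apply: val_inj; exact: u0.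
have uy : u y = 0.
  exact: (congr1 (fun h => set_val (h y : set_type J)) (etrans (esym E2) E1)).
by have := oner_neq0 R; rewrite -(u1 y erefl) uy eqxx.
Qed.

End stone_cech_theory.

(** * Approximation of a single functional *)

Section approximation.
Context {R : realType} {k : scalar_kind} {X : pcompactHausdorffType}.
Implicit Types f g : cfun R k X.

(** The cases are [m] below, above and equal to [2 * s]. A bound [c] independent of [f] is recorded
    so that strictness survives the supremum over the unit ball. *)
Lemma functional_approximation (lam : cfun R k X -> scalars R k) (eps : R) :
  (forall a f g, lam (a *: f + g) = a * lam f + lam g) ->
  (forall f, modulus (lam f) <= `|f|) ->
  0 < eps ->
  (forall f g, `|f| <= 1 -> `|g| <= 1 -> f * g = 0 ->
    modulus (lam f) * modulus (lam g) <= eps) ->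
  exists a x c, [/\ modulus a <= 1,
    forall f, `|f| <= 1 -> modulus (lam f - a * f x) <= c,
    c <= 2 * Num.sqrt eps &
    (~ exists mu : probability (borel X) R, regular_measure mu /\ atomless mu) ->
    c < 2 * Num.sqrt eps].
Proof.
move=> lamP lam_bounded1 eps0 dp; set s := Num.sqrt eps.
have s0 : 0 < s by rewrite sqrtr_gt0.
have lam_bounded f : modulus (lam f) <= 1 * `|f| by rewrite mul1r.
pose m := mass lam setT.
have m1 : m <= 1.
  by apply: mass_le => f [f1 _]; exact: le_trans (lam_bounded1 f) f1.
have zero_approx f : `|f| <= 1 -> modulus (lam f - 0 * f point) <= m.
  move=> f1; rewrite mul0r subr0; apply: (le_mass ler01 lam_bounded).
  by split=> // x /(_ I).
have atom_approx p x : (forall U, open_nbhs x U -> p <= mass lam U) ->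
    m - p < 2 * s ->
  exists a x c, [/\ modulus a <= 1,
    forall f, `|f| <= 1 -> modulus (lam f - a * f x) <= c,
    c <= 2 * s & True -> c < 2 * s].
  (* The midpoint of [m - p] and [2 * s], strictly between them. *)
  move=> xp mps; pose c := (m - p + 2 * s) / 2.
  have mpc : m - p < c by rewrite /c; lra.
  have [a am ac] := functional_near_evaluation lamP ler01 lam_bounded xp mpc.
  exists a, x, c; split => //; [exact: le_trans m1|rewrite /c; lra|rewrite /c; lra].
have [mlt|mgt|meq] := ltgtP m (2 * s).
- exists 0, point, m; split => //; [by rewrite modulus0|exact: ltW].
- have [p mp [x xp]] := mass_large_point lamP ler01 lam_bounded eps0 dp mgt.
  have [|a [y [c [? ? ? cs]]]] := atom_approx p x xp.
    by rewrite -/m -/s in mp; lra.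
  by exists a, y, c; split => // _; exact: cs.
have [muP|muN] := pselect (exists mu : probability (borel X) R,
    regular_measure mu /\ atomless mu).
  exists 0, point, m; split => //; [by rewrite modulus0|by rewrite meq].
(* In the borderline case an atom of any positive mass [e] suffices, since [m - e < 2 * s]. *)
suff [x [e e0 xe]] : exists x, exists2 e, 0 < e &
    forall U, open_nbhs x U -> e <= mass lam U.
  have [|a [y [c [? ? ? cs]]]] := atom_approx e x xe; first by rewrite meq; lra.
  by exists a, y, c; split => // _; exact: cs.
apply: contrapT => small; apply: muN.
have m0 : 0 < m by rewrite meq; lra.
have im0 : 0 < m^-1 by rewrite invr_gt0.
(* Normalization to total variation 1, the mass required of a probability. *)
pose lam' f := embed m^-1 * lam f : scalars R k.
have lam'E f : modulus (lam' f) = m^-1 * modulus (lam f).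
  by rewrite modulusM modulus_embed gtr0_norm.
have massE U : mass lam' U = m^-1 * mass lam U.
  apply/le_anti/andP; split.
    apply: mass_le => f Uf; rewrite lam'E ler_pM2l //.
    exact: (le_mass ler01 lam_bounded).
  rewrite ler_pdivrMl //; apply: mass_le => f Uf.
  rewrite -ler_pdivrMl // -lam'E; apply: (le_mass (ltW im0)) => // g.
  by rewrite lam'E ler_pM2l.
apply: (exists_regular_atomless_probability (lam := lam') (C := m^-1)).
- by move=> a f g; rewrite /lam' lamP mulrDr mulrCA.
- exact: ltW.
- by move=> f; rewrite lam'E ler_pM2l.
- by rewrite massE mulVf ?gt_eqF.
move=> x e e0; apply: contrapT => xe; apply: small; exists x, (m * e).
  exact: mulr_gt0.
move=> U xU; rewrite leNgt; apply/negP => Ue; apply: xe; exists U => //.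
by rewrite massE ltr_pdivrMl.
Qed.

End approximation.

(** * Norm and disjointness bounds for operators *)

Lemma opnorm_le (R : realType) (V W : normedZmodType R) (T : V -> W) (c : R) :
  (forall v, `|v| <= 1 -> `|T v| <= c) -> (opnorm T <= c%:E)%E.
Proof.
by move=> Tc; apply: ge_ereal_sup => _ [v v1 <-]; rewrite lee_fin; exact: Tc.
Qed.

Section operator.
Context {R : realType} {k : scalar_kind} {X Y : compactHausdorffType}.
Implicit Types f g : cfun R k X.
Variable T : cfun R k X -> cfun R k Y.
Hypothesis linT : linear T.

Let T0 : T 0 = 0.
Proof. by have := linT (-1) 0 0; rewrite scaler0 addr0 scaleN1r addNr. Qed.

Let TZ a f : T (a *: f) = a *: T f.
Proof. by have := linT a f 0; rewrite !addr0 T0 addr0. Qed.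

Lemma opnorm1_bound f : opnorm T = 1%E -> `|T f| <= `|f|.
Proof.
move=> T1; have [->|/eqP f0] := eqVneq f 0; first by rewrite T0 !normr0.
have [g g1 fg] := cfun_unit_scaling f0.
rewrite fg TZ !cfun_normZ ler_wpM2l ?modulus_ge0 // g1 -lee_fin -T1.
by apply: ereal_sup_ubound; exists g => //=; rewrite g1.
Qed.

(** The definition speaks of norm exactly 1. Factoring out the norms multiplies the product by
    [|f| * |g| <= 1]; zero functions are treated apart. *)
Lemma disjointness_preserving_ball eps f g : 0 < eps ->
  disjointness_preserving eps T -> `|f| <= 1 -> `|g| <= 1 -> f * g = 0 ->
  `|T f * T g| <= eps.
Proof.
move=> eps0 [_ _ dp] f1 g1 fg0.
have [->|/eqP f0] := eqVneq f 0; first by rewrite T0 mul0r normr0 ltW.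
have [->|/eqP g0] := eqVneq g 0; first by rewrite T0 mulr0 normr0 ltW.
have [f' f'1 ff'] := cfun_unit_scaling f0.
have [g' g'1 gg'] := cfun_unit_scaling g0.
set c := embed `|f| * embed `|g| : scalars R k.
have cE : modulus c = `|f| * `|g| by rewrite modulusM !modulus_embed !normr_id.
have c0 : c != 0.
  apply/eqP => c0; have := cE; rewrite c0 modulus0 => /esym/eqP.
  by rewrite mulf_eq0 !normr_eq0 => /orP[] /eqP.
have fg'0 : f' * g' = 0.
  have : c *: (f' * g') = 0 by rewrite -cfun_scaleM -ff' -gg'.
  by move/(congr1 ( *:%R c^-1)); rewrite scalerA mulVf // scale1r scaler0.
have -> : T f * T g = c *: (T f' * T g') by rewrite {1}ff' {1}gg' !TZ cfun_scaleM.
rewrite cfun_normZ cE; apply: le_trans (dp f' g' f'1 g'1 fg'0).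
by rewrite ler_piMl // mulr_ile1.
Qed.

End operator.

(** * Assembly of the weighted composition map *)

Theorem theorem3p2 (R : realType) (k : scalar_kind) (eps : R)
    (X : pcompactHausdorffType) (D : discreteTopologicalType)
    (Y : compactHausdorffType) (i : D -> Y)
    (T : cfun R k X -> cfun R k Y) :
  0 < eps -> eps < 1 / 4 ->
  (exists d1 d2 : D, d1 <> d2) ->
  stone_cech i ->
  infinite_set [set: X] ->
  disjointness_preserving eps T ->
  opnorm T = 1%E ->
  (exists S : cfun R k X -> cfun R k Y,
     weighted_composition S /\
     (opnorm (T \- S)%R <= (2 * Num.sqrt eps)%R%:E)%E) /\
  ((~ exists mu : probability (borel X) R, regular_measure mu /\ atomless mu) ->
   finite_set [set: Y] ->
   exists S : cfun R k X -> cfun R k Y,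
     weighted_composition S /\
     (opnorm (T \- S)%R < (2 * Num.sqrt eps)%R%:E)%E).
Proof.
move=> eps0 _ _ iP _ dT T1; have [linT _ _] := dT.
have /choice[al /choice[x /choice[c cP]]] : forall d : D, exists a x c,
    [/\ modulus a <= 1,
    forall f : cfun R k X, `|f| <= 1 -> modulus (T f (i d) - a * f x) <= c,
    c <= 2 * Num.sqrt eps &
    (~ exists mu : probability (borel X) R, regular_measure mu /\ atomless mu) ->
    c < 2 * Num.sqrt eps].
  move=> d; apply: (functional_approximation (lam := fun f => T f (i d))) => //.
  - by move=> a f g; rewrite linT.
  - move=> f.
    exact: le_trans (le_cfun_norm (T f) (i d)) (opnorm1_bound linT f T1).
  - move=> f g f1 g1 fg0; rewrite -modulusM.
    exact: le_trans (le_cfun_norm (T f * T g) (i d))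
      (disjointness_preserving_ball linT eps0 dT f1 g1 fg0).
(* The weights lie in the compact unit disc and the points in the compact space [X], so both
   families extend continuously to [Y]. *)
have [a' [ca aE]] := stone_cech_compact_extension iP (@scalars_hausdorff R k)
  (@compact_unit_disc R k) (fun d => let: And4 h _ _ _ := cP d in h).
pose a : cfun R k Y := mkcts ca.
have [h [ch hE]] := stone_cech_compact_extension iP (@hausdorffT X)
  (@compactT X) (fun d => (I : [set: X] (x d))).
have cfh (f : cfun R k X) : continuous (f \o h).
  by move=> y; apply: continuous_comp; [exact: ch|exact: cts_fun].
pose S f : cfun R k Y := a * (mkcts (cfh f) : cfun R k Y).
have wS : weighted_composition S.
  by exists a, h; split => //; exact: continuous_subspaceT.
have TSd d f : `|f| <= 1 -> modulus ((T f - S f) (i d)) <= c d.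
  move=> f1; have [_ /(_ f f1) + _ _] := cP d.
  by change (modulus (T f (i d) - al d * f (x d)) <= c d ->
    modulus (T f (i d) - a' (i d) * f (h (i d))) <= c d); rewrite aE hE.
(* The bound is a closed condition on [y], so it passes from the dense image of [D] to [Y]. *)
have TS e : 0 <= e -> (forall d, c d <= e) -> (opnorm (T \- S)%R <= e%:E)%E.
  move=> e0 ce; apply: opnorm_le => f f1; apply: cfun_norm_le => //.
  apply: (stone_cech_dense iP R) => [|d]; last exact: le_trans (TSd d f f1) (ce d).
  apply: (@preimage_closed _ _ _ [set r | r <= e]); last exact: closed_le.
  by move=> y _; exact: (@modulus_cfun_continuous _ _ _ (T f - S f)).
have s0 : 0 < 2 * Num.sqrt eps by rewrite mulr_gt0 ?sqrtr_gt0.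
split.
  by exists S; split => //; apply: TS => [|d]; [exact: ltW|have [] := cP d].
move=> muN finY; exists S; split => //.
(* In a finite [Y] the range of [i] is closed, hence everything; the maximum of the finitely many
   strict bounds [c (j y)] is again strict. *)
have /choice[j jP] : forall y, exists d, i d = y.
  move=> y; have cl : closed (range i).
    have /accessible_finite_set_closed := hausdorff_accessible (@hausdorffT Y).
    by apply; exact: sub_finite_set finY.
  by have [|d _ <-] := stone_cech_dense iP R cl _ y; [move=> d; exists d|exists d].
have /finite_seqP[s sE] := finY.
have [e [e0 es ce]] : exists e, [/\ 0 <= e, e < 2 * Num.sqrt eps &
    forall y, y \in s -> c (j y) <= e].
  elim: s {sE} => [|y s [e [e0 es ce]]].
    by exists 0; split => // y; rewrite inE.
  have [_ _ _ /(_ muN) cs] := cP (j y).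
  exists (Num.max e (c (j y))); split; first by rewrite le_max e0.
    by rewrite gt_max es.
  by move=> z; rewrite inE le_max => /orP[/eqP ->|/ce ->//]; rewrite lexx orbT.
apply: (@le_lt_trans _ _ e%:E); last by rewrite lte_fin.
apply: opnorm_le => f f1; apply: cfun_norm_le => // y.
have ys : y \in s by have : [set: Y] y := I; rewrite sE.
by rewrite -[y]jP; exact: le_trans (TSd (j y) f f1) (ce y ys).
Qed.
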